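(* Let $A\in \mathbb{Z}^{(m+1)\times(d+1)}$ be such that $\mathrm{rowspan}(A)\subset\mathbb{R}^{d+1}$ is a subspace of dimension $m+1$ containing the vector $(1,\dots,1)\in\mathbb{R}^{d+1}$. Then the following hold. (i) Given another matrix $A'\in\mathbb{Z}^{(m+1)\times(d+1)}$ such that $\mathrm{rowspan}(A')$ has dimension $m+1$ and contains the vector $(1,\dots,1)\in\mathbb{R}^{d+1}$, one has $X_A=X_{A'}$ (as subvarieties of $\mathbb{P}^d$) if and only if $\mathrm{rowspan}(A)=\mathrm{rowspan}(A')$. (ii) The embedded tangent space to $X_A\subset\mathbb{P}^d$ at the point $\mathbf{1}=(1:\dots:1)\in X_A$ is the projectivization $\mathbb{P}(\mathrm{rowspan}(A)\otimes_{\mathbb{R}}\mathbb{C})$. Moreover, let $L\subset\mathbb{R}^{d+1}$ be a linear subspace of dimension $m+1$ which is defined over $\mathbb{Q}$ and such that $(1,\dots,1)\in L$. Let $L_{\mathbb{C}}=L\otimes_{\mathbb{R}}\mathbb{C}\subset\mathbb{C}^{d+1}$ and let $\mathbb{P}(L_{\mathbb{C}})\subset\mathbb{P}^d$ be its projectivization. Then there exists a unique equivariantly embedded toric variety $X_A\subset\mathbb{P}^d$ such that $\mathbb{P}(L_{\mathbb{C}})$ is the embedded tangent space $T_{X_A,\mathbf{1}}$ of $X_A$ at $\mathbf{1}$. Indeed, it is enough to take any matrix $A\in\mathbb{Z}^{(m+1)\times(d+1)}$ such that $L=\mathrm{rowspan}(A)$.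
   Context: $\mathbb{P}^d$ is complex projective $d$-space. For an integer matrix $A$ with $d+1$ columns whose row span contains $(1,\dots,1)$, the equivariantly embedded projective toric variety $X_A\subset\mathbb{P}^d$ is the Zariski closure of the image of the monomial map sending $\mathbf{s}$ in the complex torus (with one coordinate for each row of $A$) to $(\mathbf{s}^{\mathbf{c}_0}:\cdots:\mathbf{s}^{\mathbf{c}_d})$, where $\mathbf{c}_0,\dots,\mathbf{c}_d$ are the columns of $A$ and $\mathbf{s}^{\mathbf{c}}=\prod_i s_i^{c_i}$. If the columns have the form $\mathbf{c}_j=(1,\mathbf{a}_j)$, this is the closure of the image of $\mathbf{t}\mapsto(\mathbf{t}^{\mathbf{a}_0}:\cdots:\mathbf{t}^{\mathbf{a}_d})$, $\mathbf t\in(\mathbb{C}^* )^m$. The variety $X_A$ contains $\mathbf{1}=(1:\dots:1)$ and is the closure of the orbit of $\mathbf{1}$ under the corresponding diagonal torus action. The equivariantly embedded toric varieties considered are those of the form $X_A$, with $A$ an integer matrix of maximal rank whose row span contains $(1,\dots,1)$. $\mathrm{rowspan}(A)$ is the real span of the rows of $A$. A subspace of $\mathbb{R}^{d+1}$ is defined over $\mathbb{Q}$ if it is spanned by vectors in $\mathbb{Q}^{d+1}$. The embedded tangent space $T_{X,p}$ of a variety $X\subset\mathbb{P}^d$ at a smooth point $p$ is the linear subspace of $\mathbb{P}^d$ of dimension $\dim X$ tangent to $X$ at $p$. *)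

(* Defs.v *)
From HB Require Import structures.
From mathcomp Require Import all_boot all_order all_algebra.
From mathcomp Require Import classical_sets reals.
From mathcomp Require Import complex.
From mathcomp Require Import mpoly.
Set Implicit Arguments.
Unset Strict Implicit.
Unset Printing Implicit Defensive.
Import Order.TTheory GRing.Theory Num.Theory.
Local Open Scope classical_set_scope.
Local Open Scope ring_scope.
Local Open Scope complex_scope.

Section ProjectiveGeometry.
Variables (K : fieldType) (d : nat).

(* P^d is the set of lines through the origin of K^(d+1). *)
Definition proj_space : Type :=
  {l : {vspace 'rV[K]_d.+1} | \dim l == 1%N}.

(* [v] is a vector of homogeneous coordinates of [p]; since the line [p] has
   dimension 1, this forces [v != 0]. *)
Definition homog_coords (p : proj_space) (v : 'rV[K]_d.+1) : Prop :=
  sval p = <[v]>%VS.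

Lemma dim_line_one : \dim <[const_mx 1 : 'rV[K]_d.+1]>%VS == 1%N.
Proof.
rewrite dim_vline; suff -> : const_mx 1 != 0 :> 'rV[K]_d.+1 by [].
by apply/eqP => /matrixP/(_ 0 0)/eqP; rewrite !mxE oner_eq0.
Qed.

Definition proj_one : proj_space :=
  exist _ <[const_mx 1 : 'rV[K]_d.+1]>%VS dim_line_one.

Definition projectivization (V : {vspace 'rV[K]_d.+1}) : set proj_space :=
  [set p | (sval p <= V)%VS].

Definition homogeneous (f : {mpoly K[d.+1]}) : Prop :=
  exists k : nat, f \is k.-homog.

Definition zero_locus (I : set {mpoly K[d.+1]}) : set proj_space :=
  [set p | forall f, I f -> forall v, homog_coords p v -> f.@[v 0] = 0].

Definition zariski_closed (Z : set proj_space) : Prop :=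
  exists2 I : set {mpoly K[d.+1]}, I `<=` homogeneous & Z = zero_locus I.

Definition zariski_closure (S : set proj_space) : set proj_space :=
  smallest zariski_closed S.

Definition zariski_irreducible (Z : set proj_space) : Prop :=
  Z !=set0 /\
  forall Z1 Z2, zariski_closed Z1 -> zariski_closed Z2 ->
    Z `<=` Z1 `|` Z2 -> Z `<=` Z1 \/ Z `<=` Z2.

Definition projective_variety (X : set proj_space) : Prop :=
  zariski_closed X /\ zariski_irreducible X.

Definition irreducible_chain (X : set proj_space) (n : nat)
    (Z : nat -> set proj_space) : Prop :=
  (forall i, (i <= n)%N -> projective_variety (Z i) /\ Z i `<=` X) /\
  (forall i, (i < n)%N -> Z i `<` Z i.+1).

(* Krull dimension; only meaningful for closed [X], as the members of a chain
   are taken closed in P^d rather than in X. *)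
Definition has_dimension (X : set proj_space) (n : nat) : Prop :=
  (exists Z, irreducible_chain X n Z) /\
  (forall k Z, irreducible_chain X k Z -> (k <= n)%N).

(* The linear space cut out by the differentials at [p] of the homogeneous
   polynomials vanishing on [X]. *)
Definition tangent_locus (X : set proj_space) (p : proj_space) :
    set proj_space :=
  [set q | forall f, homogeneous f -> X `<=` zero_locus [set f] ->
    forall u v, homog_coords p u -> homog_coords q v ->
      \sum_(i < d.+1) f^`M(i).@[u 0] * v 0 i = 0].

Definition smooth_point (X : set proj_space) (p : proj_space) : Prop :=
  X p /\
  exists (n : nat) (V : {vspace 'rV[K]_d.+1}),
    [/\ has_dimension X n, tangent_locus X p = projectivization V &
        \dim V = n.+1].

(* Smoothness of [p] makes [T] a linear subspace of dimension [dim X]. *)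
Definition is_embedded_tangent_space (X : set proj_space) (p : proj_space)
    (T : set proj_space) : Prop :=
  [/\ projective_variety X, smooth_point X p & T = tangent_locus X p].

Definition monomial_vector (r : nat) (A : 'M[int]_(r, d.+1)) (s : 'I_r -> K) :
    'rV[K]_d.+1 :=
  \row_(j < d.+1) \prod_(i < r) s i ^ A i j.

Definition monomial_image (r : nat) (A : 'M[int]_(r, d.+1)) :
    set proj_space :=
  [set p | exists2 s : 'I_r -> K, (forall i, s i != 0) &
             homog_coords p (monomial_vector A s)].

Definition toric_variety (r : nat) (A : 'M[int]_(r, d.+1)) : set proj_space :=
  zariski_closure (monomial_image A).

End ProjectiveGeometry.

Arguments proj_one K d : clear implicits.
Arguments toric_variety K {d r} A.

Section RealSubspaces.
Variables (R : realType) (d : nat).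

Definition rowspan (r : nat) (A : 'M[int]_(r, d.+1)) : {vspace 'rV[R]_d.+1} :=
  <<[seq row i (map_mx intr A) | i <- enum 'I_r]>>%VS.

Definition defined_over_rat (L : {vspace 'rV[R]_d.+1}) : Prop :=
  exists s : seq 'rV[rat]_d.+1,
    L = <<[seq map_mx (ratr : rat -> R) v | v <- s]>>%VS.

(* L (x) C inside C^(d+1) is the complex span of L, so the choice of the basis
   of L is immaterial. *)
Definition complexification (L : {vspace 'rV[R]_d.+1}) :
    {vspace 'rV[R[i]]_d.+1} :=
  <<[seq map_mx (real_complex R) v | v <- vbasis L]>>%VS.

(* The number of rows is arbitrary; [minn r d.+1] is the maximal rank of an
   r x (d+1) matrix. *)
Definition is_equivariantly_embedded_toric (X : set (proj_space R[i] d)) :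
    Prop :=
  exists (r : nat) (A : 'M[int]_(r, d.+1)),
    [/\ \dim (rowspan A) = minn r d.+1, const_mx 1 \in rowspan A &
        X = toric_variety R[i] A].

End RealSubspaces.

Arguments rowspan R {d r} A.

(* Main.v *)
(** Everything about the dimension and the tangent space of X_A is read off the
    pullbacks f(s^A) of forms f along the monomial map.

    - If the row span of A lies in that of A', then k A = B A' for integral B
      and some k > 0; taking k-th roots of the torus coordinates, the image of
      the monomial map of A lies in that of A'.
    - The tangent space at (1:...:1) contains the rows of A (differentiate
      f(s^A) = 0 along the coordinates of the torus) and is cut out by the
      differentials of the binomials x^a - x^b with A a = A b. So X_A determines
      the row span.
    - X_A has chains of length m of irreducible closed subsets: take X_{A'}
      for A' spanning the members of a rational flag through (1,...,1).
    - There are no longer chains: a chain of length n makes the Hilbert function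
      of X_A grow at least like k^n, by multiplying with forms separating its
      members, whereas a form of degree k restricts to a combination of
      O(k^m) characters of the torus. *)

Require Import Defs.
From mathcomp Require Import all_boot all_order all_algebra.
From mathcomp Require Import classical_sets reals complex.
From mathcomp Require Import boolp mpoly zify.
Import Order.TTheory GRing.Theory Num.Theory.
Local Open Scope classical_set_scope.
Local Open Scope ring_scope.
Local Open Scope complex_scope.
Set Implicit Arguments.
Unset Strict Implicit.
Unset Printing Implicit Defensive.

Local Notation ratmx A := (map_mx intr A : 'M[rat]_(_, _)).

(** * Row spans over Q, R and C *)

(** Spans of lists are turned into row spaces of matrices, where rank and base change are at hand.
    Each hypothesis gives one of the two inclusions. *)
Lemma mem_span_mx (F : fieldType) r n (X : seq 'rV[F]_n) (M : 'M_(r, n)) v :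
    (forall x, x \in X -> (x <= M)%MS) ->
    (forall i, row i M \in <<X>>%VS) ->
  (v \in <<X>>%VS) = (v <= M)%MS.
Proof.
move=> XM MX; apply/idP/idP.
- rewrite -[X]/(val (in_tuple X)) => /coord_span ->; apply: summx_sub => i _.
  by rewrite scalemx_sub // XM // mem_nth.
- move=> /submxP[w ->]; rewrite mulmx_sum_row.
  by apply: memv_suml => i _; apply: memvZ.
Qed.

Lemma mem_span_rows (F : fieldType) r n (M : 'M[F]_(r, n)) v :
  (v \in <<[seq row i M | i <- enum 'I_r]>>%VS) = (v <= M)%MS.
Proof.
apply: mem_span_mx => [x /mapP[i _ ->]|i]; first exact: row_sub.
by apply: memv_span; apply: map_f; rewrite mem_enum.
Qed.

Lemma dim_span_rows (F : fieldType) r n (M : 'M[F]_(r, n)) :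
  \dim <<[seq row i M | i <- enum 'I_r]>>%VS = \rank M.
Proof.
set B := row_base M.
have -> : <<[seq row i M | i <- enum 'I_r]>>%VS =
    <<[seq row i B | i <- enum 'I_(\rank M)]>>%VS.
  by apply/vspaceP => v; rewrite !mem_span_rows eq_row_base.
have sizeB : size [seq row i B | i <- enum 'I_(\rank M)] == \rank M.
  by rewrite size_map size_enum_ord.
suff /eqP : free (Tuple sizeB) by rewrite (eqP sizeB).
apply/freeP => k; have nthB i : (Tuple sizeB)`_(nat_of_ord i) = row i B.
  by rewrite (nth_map i) ?size_enum_ord // nth_ord_enum.
move=> kB i; have := row_base_free M; rewrite -kermx_eq0 => /eqP kerB.
have /sub_kermxP : (\row_i k i) *m B = 0.
  rewrite mulmx_sum_row; apply: etrans kB.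
  by apply: eq_bigr => j _; rewrite mxE -nthB.
by rewrite kerB submx0 => /eqP/matrixP/(_ 0 i); rewrite !mxE.
Qed.

Section RationalStructure.
Variable F : numFieldType.

Lemma map_mx_intr_ratr r n (A : 'M[int]_(r, n)) :
  map_mx intr A = map_mx (ratr : rat -> F) (map_mx intr A).
Proof. by apply/matrixP => i j; rewrite !mxE ratr_int. Qed.

(** Inclusion of row spaces is insensitive to field extension. For integral matrices it can thus be
    tested over the rationals, whether [F] is real or complex. *)
Lemma submx_intr r r' n (A : 'M[int]_(r, n)) (A' : 'M[int]_(r', n)) :
  ((map_mx intr A : 'M[F]_(r, n)) <= (map_mx intr A' : 'M[F]_(r', n)))%MS =
  (ratmx A <= ratmx A')%MS.
Proof. by rewrite !map_mx_intr_ratr map_submx. Qed.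

Lemma mxrank_intr r n (A : 'M[int]_(r, n)) :
  \rank (map_mx intr A : 'M[F]_(r, n)) = \rank (ratmx A).
Proof. by rewrite map_mx_intr_ratr mxrank_map. Qed.

Lemma const1_sub_intr r n (A : 'M[int]_(r, n)) :
  ((const_mx 1 : 'rV_n) <= (map_mx intr A : 'M[F]_(r, n)))%MS =
  ((const_mx 1 : 'rV_n) <= ratmx A)%MS.
Proof.
suff const1 (k : nzRingType) :
    const_mx 1 = map_mx intr (const_mx 1 : 'rV[int]_n) :> 'rV[k]_n.
  by rewrite (const1 F) (const1 rat) submx_intr.
by apply/rowP => i; rewrite !mxE.
Qed.

End RationalStructure.

Lemma clear_denominators r n (M : 'M[rat]_(r, n)) :
  exists2 k : nat, (0 < k)%N &
    exists A : 'M[int]_(r, n), map_mx intr A = k%:R *: M.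
Proof.
exists (\prod_i \prod_j `|denq (M i j)|)%N.
  by apply: prodn_gt0 => i; apply: prodn_gt0 => j; rewrite absz_gt0 denq_neq0.
have intM i j : exists z : int,
    z%:~R = (\prod_i \prod_j `|denq (M i j)|)%N%:R * M i j.
  rewrite (bigD1 i) //= (bigD1 j) //= -mulnA natrM.
  (* [N] is the product of the denominators of all the other entries. *)
  set N := (X in _ * X%:R * _); exists (N%:Z * numq (M i j)).
  rewrite rmorphM /= numqE [LHS]mulrC [RHS]mulrC mulrA; congr (_ * _ * _).
  by rewrite pmulrn absz_denq.
exists (\matrix_(i, j) projT1 (cid (intM i j))).
by apply/matrixP => i j; rewrite !mxE (projT2 (cid (intM i j))).
Qed.

Lemma eqmx_clear_denominators r n (M : 'M[rat]_(r, n)) :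
  exists A : 'M[int]_(r, n), (map_mx intr A :=: M)%MS.
Proof.
have [k k_gt0 [A AE]] := clear_denominators M; exists A.
by rewrite AE; apply: eqmx_scale; rewrite pnatr_eq0 -lt0n.
Qed.

Section RealSpans.
Variables (R : realType) (d : nat).

Lemma mem_rowspan r (A : 'M[int]_(r, d.+1)) v :
  (v \in rowspan R A) = (v <= map_mx intr A)%MS.
Proof. exact: mem_span_rows. Qed.

Lemma dim_rowspan r (A : 'M[int]_(r, d.+1)) :
  \dim (rowspan R A) = \rank (ratmx A).
Proof. by rewrite dim_span_rows mxrank_intr. Qed.

Lemma rowspan_subE r r' (A : 'M[int]_(r, d.+1)) (A' : 'M[int]_(r', d.+1)) :
  (rowspan R A <= rowspan R A')%VS =
  (ratmx A <= ratmx A')%MS.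
Proof.
rewrite -(submx_intr R); apply/subvP/row_subP => AA'.
  by move=> i; rewrite -mem_rowspan AA' // mem_rowspan row_sub.
move=> v; rewrite !mem_rowspan => /submx_trans; apply.
by apply/row_subP.
Qed.

(** Membership in a row space does not change under the extension from real to complex scalars. So
    [L] can be read off its complexification, as the set of its real vectors. *)
Lemma map_mem_complexification (L : {vspace 'rV[R]_d.+1}) v :
  (map_mx (real_complex R) v \in complexification L) = (v \in L).
Proof.
set B := \matrix_(i < \dim L) tnth (vbasis L) i.
have rowB i : row i B = tnth (vbasis L) i by apply/rowP => j; rewrite !mxE.
have -> : (v \in L) = (v <= B)%MS.
  rewrite -[in LHS](span_basis (vbasisP L));
    apply: mem_span_mx => [x /tnthP[i ->]|i].
    by rewrite -rowB row_sub.
  by rewrite rowB; apply: memv_span; rewrite mem_tnth.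
rewrite -(map_submx (real_complex R)); apply: mem_span_mx => [x|i].
  by move=> /mapP[y /tnthP[i ->] ->]; rewrite -rowB map_submx row_sub.
by rewrite -map_row rowB; apply: memv_span; rewrite map_f ?mem_tnth.
Qed.

Lemma complexification_inj (L L' : {vspace 'rV[R]_d.+1}) :
  complexification L = complexification L' -> L = L'.
Proof.
by move=> LL'; apply/vspaceP => v; rewrite -!map_mem_complexification LL'.
Qed.

Lemma mem_complexification_rowspan r (A : 'M[int]_(r, d.+1)) v :
  (v \in complexification (rowspan R A)) = (v <= map_mx intr A)%MS.
Proof.
have -> : map_mx intr A = map_mx (real_complex R) (map_mx intr A).
  by apply/matrixP => i j; rewrite !mxE rmorph_int.
apply: mem_span_mx => [x /mapP[y /vbasis_mem yA ->]|i].
  by rewrite map_submx -mem_rowspan.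
by rewrite -map_row map_mem_complexification mem_rowspan row_sub.
Qed.

Lemma complexification_rowspanE r (A : 'M[int]_(r, d.+1)) :
  complexification (rowspan R A) =
  <<[seq row i (map_mx intr A) | i <- enum 'I_r]>>%VS.
Proof.
by apply/vspaceP => v; rewrite mem_complexification_rowspan mem_span_rows.
Qed.

(** A [row_base] of the rational generators has exactly [m] rows, and clearing its denominators
    keeps the row space. *)
Lemma rational_rowspan m (L : {vspace 'rV[R]_d.+1}) :
  \dim L = m -> defined_over_rat L ->
  exists A : 'M[int]_(m, d.+1), L = rowspan R A.
Proof.
move=> dimL [s LE].
set S := \matrix_(i < size s) s`_i : 'M[rat]_(size s, d.+1).
have memL v : (v \in L) = (v <= map_mx (ratr : rat -> R) S)%MS.
  have rowS i : row i S = s`_i by apply/rowP => j; rewrite !mxE.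
  rewrite LE; apply: mem_span_mx => [x /mapP[y /(nthP 0)[i i_lt <-] ->]|i].
    by rewrite -(rowS (Ordinal i_lt)) map_submx row_sub.
  by rewrite -map_row rowS; apply: memv_span; rewrite map_f ?mem_nth.
have rankS : \rank S = m.
  rewrite -(mxrank_map (ratr : rat -> R)) -dim_span_rows -dimL; congr (\dim _).
  by apply/vspaceP => v; rewrite mem_span_rows memL.
have [A AE] := eqmx_clear_denominators (row_base S).
rewrite -rankS; exists A; apply/vspaceP => v.
rewrite mem_rowspan memL map_mx_intr_ratr.
apply/idP/idP => /submx_trans; apply; rewrite map_submx.
  by rewrite AE eq_row_base.
by rewrite AE eq_row_base.
Qed.

End RealSpans.

(** * Zariski closed sets *)

Section ZariskiTopology.
Variables (K : fieldType) (d : nat).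
Implicit Types (p : proj_space K d) (u v : 'rV[K]_d.+1) (f g : {mpoly K[d.+1]}).
Implicit Types X Z : set (proj_space K d).

Lemma homog_coords_neq0 p v : homog_coords p v -> v != 0.
Proof.
case: p => l diml /= pv; apply/eqP => v0; move: (diml).
by rewrite [l]pv v0 dim_vline eqxx.
Qed.

Lemma homog_coords_exists p : exists v, homog_coords p v.
Proof.
case: p => l /= diml; exists (vpick l); apply/eqP; rewrite eq_sym eqEdim /=.
rewrite -memvE memv_pick (eqP diml) dim_vline.
by rewrite vpick0 -dimv_eq0 (eqP diml).
Qed.

Lemma homog_coords_point v : v != 0 -> exists p, homog_coords p v.
Proof.
move=> v_neq0; have dimv : \dim <[v]>%VS == 1%N by rewrite dim_vline v_neq0.
by exists (exist _ <[v]>%VS dimv).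
Qed.

Lemma homog_coordsZ p u v :
  homog_coords p u -> homog_coords p v -> exists2 c, c != 0 & v = c *: u.
Proof.
move=> pu pv; have : v \in <[u]>%VS by rewrite -pu pv memv_line.
move=> /vlineP[c vE]; exists c => //; apply: contraNneq (homog_coords_neq0 pv).
by rewrite vE => ->; rewrite scale0r.
Qed.

Lemma meval_homogZ k f c v :
  f \is k.-homog -> f.@[(c *: v) 0] = c ^+ k * f.@[v 0].
Proof.
move=> f_homog; rewrite !mevalE mulr_sumr !big_seq; apply: eq_bigr => a a_f.
under eq_bigr do rewrite mxE exprMn.
by rewrite big_split /= prodrXr -mdegE (dhomog_mf f_homog a_f) mulrCA.
Qed.

Lemma zero_locus1P k f p v : f \is k.-homog -> homog_coords p v ->
  zero_locus [set f] p <-> f.@[v 0] = 0.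
Proof.
move=> f_homog pv; split=> [/(_ f erefl v pv)//|fv0 g /= -> u pu].
by have [c c_neq0 ->] := homog_coordsZ pv pu;
  rewrite (meval_homogZ _ _ f_homog) fv0 mulr0.
Qed.

Lemma sub_zero_locus1 X f :
  (forall p v, X p -> homog_coords p v -> f.@[v 0] = 0) <->
  X `<=` zero_locus [set f].
Proof.
split=> [Xf p Xp g /= -> v|Xf p v Xp pv]; first exact: Xf.
exact: (Xf p Xp f).
Qed.

Lemma zariski_closed_zero1 f : homogeneous f ->
    zariski_closed (zero_locus [set f]).
Proof. by move=> f_homog; exists [set f] => // g /= ->. Qed.

(** A closed set is the intersection of the hypersurfaces that contain it. *)
Lemma zariski_closed_sub X Z : zariski_closed Z ->
    (forall f, homogeneous f -> Z `<=` zero_locus [set f] ->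
       X `<=` zero_locus [set f]) ->
  X `<=` Z.
Proof.
move=> [I I_homog ->] XZ p Xp f If v pv.
apply: (XZ f (I_homog f If) _ p Xp f erefl v pv) => q Zq g /= ->; exact: Zq.
Qed.

Lemma zariski_closureE X : zariski_closure X =
  zero_locus [set f | homogeneous f /\ X `<=` zero_locus [set f]].
Proof.
apply/seteqP; split.
  apply: smallest_sub => [|p Xp f /= [_ Xf]]; last exact: Xf.
  by exists [set f | homogeneous f /\ X `<=` zero_locus [set f]] => // f [].
move=> p Xp Z /= [Z_closed XZ]; apply: (zariski_closed_sub Z_closed) Xp.
move=> f f_homog Zf q Iq g /= ->; apply: Iq; split=> //.
exact: subset_trans Zf.
Qed.

Lemma zariski_closed_closure X : zariski_closed (zariski_closure X).
Proof.
rewrite zariski_closureE.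
by exists [set f | homogeneous f /\ X `<=` zero_locus [set f]] => // f [].
Qed.

Lemma zariski_closure_subP X Z : zariski_closed Z ->
  zariski_closure X `<=` Z <-> X `<=` Z.
Proof.
move=> Z_closed; split=> [|XZ]; last exact: smallest_sub.
exact: subset_trans (@sub_gen_smallest _ _ _).
Qed.

(** The homogeneous ideal of an irreducible set is prime. *)
Lemma irreducible_mul Z f g : zariski_irreducible Z ->
    homogeneous f -> homogeneous g -> Z `<=` zero_locus [set f * g] ->
  Z `<=` zero_locus [set f] \/ Z `<=` zero_locus [set g].
Proof.
move=> [_ irrZ] f_homog g_homog /sub_zero_locus1 Zfg.
apply: irrZ;
  [exact: zariski_closed_zero1|exact: zariski_closed_zero1|move=> p Zp].
have [v pv] := homog_coords_exists p.
have /eqP := Zfg p v Zp pv; rewrite mevalM mulf_eq0.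
have [[k fk] [l gl]] := (f_homog, g_homog).
by case/orP=> /eqP fg0; [left; apply/(zero_locus1P fk pv)
  | right; apply/(zero_locus1P gl pv)].
Qed.

Lemma homogeneousM f g : homogeneous f -> homogeneous g -> homogeneous (f * g).
Proof. by move=> [k fk] [l gl]; exists (k + l)%N; apply: dhomogM. Qed.

End ZariskiTopology.

(** * Hilbert functions *)

(** The binomial grows like [k^n] and the bound like [k^m]. *)
Lemma leq_of_bin_leq_exp n m c :
  (forall k, 'C(k + n, n) <= (c * k).+1 ^ m)%N -> (n <= m)%N.
Proof.
move=> le_bin; rewrite leqNgt; apply/negP => lt_mn.
(* If [m < n], the hypothesis at [k = b] gives [(b+1)^(m+1) <= n! (c b + 1)^m <= b (b+1)^m], which
   is absurd. *)
set b := (n`! * c.+1 ^ m)%N.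
have expn_ffact k : (k.+1 ^ n <= (k + n) ^_ n)%N.
  elim: (n) => [|i IHi]; first by rewrite expn0 ffactn0.
  by rewrite addnS ffactSS expnS leq_mul // ltnS leq_addr.
have : (b.+1 ^ m.+1 <= b * b.+1 ^ m)%N.
  rewrite (leq_trans (leq_pexp2l _ lt_mn)) // (leq_trans (expn_ffact b)) //.
  rewrite -bin_ffact mulnC -mulnA leq_mul2l -expnMn (leq_trans (le_bin b))
    ?orbT //.
  by case: (m) => // m'; rewrite leq_exp2r //; lia.
by rewrite expnS leq_pmul2r ?expn_gt0 // ltnn.
Qed.

Section HilbertFunction.
Variables (K : fieldType) (d : nat).
Implicit Types X Z : set (proj_space K d).

(** This encodes that the Hilbert function of [X] at [k] is at least [N]: the forms [g i] are
    linearly independent modulo the ideal of [X]. *)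
Definition independent_forms X k N : Prop :=
  exists2 g : 'I_N -> {mpoly K[d.+1]}, (forall i, g i \is k.-homog) &
    forall a : 'I_N -> K, X `<=` zero_locus [set \sum_i a i *: g i] ->
      forall i, a i = 0.

Lemma independent_forms_subset X Z k N :
  Z `<=` X -> independent_forms Z k N -> independent_forms X k N.
Proof.
move=> ZX [g g_homog g_indep]; exists g => // a Xa; apply: g_indep.
exact: subset_trans Xa.
Qed.

Lemma independent_forms_leq X k N N' :
  (N' <= N)%N -> independent_forms X k N -> independent_forms X k N'.
Proof.
move=> /subnKC <-; move: (N - N')%N => M [g g_homog g_indep].
exists (g \o lshift M) => [i|a Xa i]; first exact: g_homog.
pose b (i : 'I_(N' + M)) := if split i is inl j then a j else 0.
have bl j : b (lshift M j) = a j by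
  rewrite /b -[lshift _ _]/(unsplit (inl j)) unsplitK.
rewrite -bl; apply: g_indep; rewrite big_split_ord /= [X in _ + X]big1 ?addr0.
  by under eq_bigr do rewrite bl.
by move=> j _; rewrite /b -[rshift _ _]/(unsplit (inr j)) unsplitK scale0r.
Qed.

Lemma independent_forms1 X k : X !=set0 -> independent_forms X k 1.
Proof.
move=> [p Xp]; have [v pv] := homog_coords_exists p.
have /rV0Pn[i vi_neq0] := homog_coords_neq0 pv.
exists (fun=> 'X_i ^+ k) => [_|a /sub_zero_locus1/(_ p v Xp pv)/eqP a0 j].
  by rewrite -[k in k.-homog]mul1n dhomogMn // dhomogX /= mdeg1.
move: a0; rewrite big_ord1 mevalZ rmorphXn /= mevalXU mulf_eq0 expf_eq0.
by rewrite (negPf vi_neq0) andbF orbF [j]ord1 => /eqP.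
Qed.

(* A relation between the [g1 j] and the [f * g2 j] on [X] restricts to one
   between the [g1 j] on [Z]; what is left can be divided by [f], as [X] is
   irreducible. *)
Lemma independent_forms_add X Z f k l N1 N2 :
    zariski_irreducible X -> Z `<=` X -> f \is l.-homog ->
    Z `<=` zero_locus [set f] -> ~ X `<=` zero_locus [set f] ->
    independent_forms Z (k + l) N1 -> independent_forms X k N2 ->
  independent_forms X (k + l) (N1 + N2).
Proof.
move=> irrX ZX f_homog Zf Xf [g1 g1_homog g1_indep] [g2 g2_homog g2_indep].
pose g (i : 'I_(N1 + N2)) := match split i with inl j => g1 j | inr j =>
  f * g2 j end.
have gl j : g (lshift N2 j) = g1 j.
  by rewrite /g -[lshift _ _]/(unsplit (inl j)) unsplitK.
have gr j : g (rshift N1 j) = f * g2 j.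
  by rewrite /g -[rshift _ _]/(unsplit (inr j)) unsplitK.
exists g => [i|a]; first rewrite /g; first case: split => j //.
  by rewrite addnC dhomogM.
rewrite big_split_ord /=.
under eq_bigr do rewrite gl.
under [X in _ + X]eq_bigr do rewrite gr scalerAr.
rewrite -mulr_sumr => /sub_zero_locus1 Xa.
have al j : a (lshift N2 j) = 0.
  apply: (g1_indep (a \o lshift N2)); apply/sub_zero_locus1 => p v Zp pv.
  have := Xa p v (ZX p Zp) pv; rewrite mevalD mevalM.
  by rewrite ((sub_zero_locus1 Z f).2 Zf p v) // mul0r addr0.
have ar j : a (rshift N1 j) = 0.
  move: j; apply: g2_indep.
  have [] := @irreducible_mul _ _ X f (\sum_j a (rshift N1 j) *: g2 j) irrX.
  - by exists l.
  - by exists k; apply: rpred_sum => j _; apply/rpredZ/g2_homog.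
  - apply/sub_zero_locus1 => p v Xp pv; rewrite -(Xa p v Xp pv).
    by rewrite [X in X + _]big1 ?add0r // => j _; rewrite al scale0r.
  - by [].
  - by [].
by move=> i; rewrite -(splitK i); case: split.
Qed.

Lemma separating_form X Z : zariski_closed Z -> ~ X `<=` Z ->
  exists2 f, homogeneous f &
    Z `<=` zero_locus [set f] /\ ~ X `<=` zero_locus [set f].
Proof.
move=> Z_closed XZ; apply: contra_notP XZ => nof.
apply: (zariski_closed_sub Z_closed) => f f_homog Zf.
by apply: contrapT => Xf; apply: nof; exists f.
Qed.

(** With [c' = e * c], where [e] is the degree of a form separating [Z] from [X], induction on [k]
    adds a bound for [Z] in degree [c' * k.+1] to one for [X] in degree [c' * k]. The two binomials
    add up by Pascal's rule. *)
Lemma independent_forms_step X Z n c :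
    zariski_closed Z -> Z !=set0 -> zariski_irreducible X -> Z `<` X ->
    (0 < c)%N -> (forall k, independent_forms Z (c * k) 'C(k + n, n)) ->
  exists2 c', (0 < c')%N &
    forall k, independent_forms X (c' * k) 'C(k + n.+1, n.+1).
Proof.
move=> Z_closed [p Zp] irrX [ZX XZ] c_gt0 indepZ.
have [f [e f_homog] [Zf Xf]] := separating_form Z_closed XZ.
(* A form of degree 0 is constant; vanishing at a point of [Z], it would vanish on all of [X]. *)
have e_gt0 : (0 < e)%N.
  rewrite lt0n; apply: contra_notN Xf => /eqP e0.
  have constf (u : 'rV_d.+1) : f.@[u 0] = f.@[(0 : 'rV_d.+1) 0].
    by rewrite -(scale0r u) (meval_homogZ _ _ f_homog) e0 mul1r.
  have [v pv] := homog_coords_exists p.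
  apply/sub_zero_locus1 => q u _ _; rewrite constf -(constf v).
  exact: (sub_zero_locus1 Z f).2 Zf p v Zp pv.
(* The power [c] makes the degree of the separating form a multiple of [c], the only degrees in
   which [Z] is controlled. *)
have Zfc : Z `<=` zero_locus [set f ^+ c].
  apply/sub_zero_locus1 => q u Zq qu; rewrite rmorphXn /=.
  by rewrite ((sub_zero_locus1 Z f).2 Zf q u) // expr0n gtn_eqF.
have Xfc : ~ X `<=` zero_locus [set f ^+ c].
  apply: contra_not Xf => /sub_zero_locus1 Xfc;
    apply/sub_zero_locus1 => q u Xq qu.
  have /eqP := Xfc q u Xq qu; rewrite rmorphXn /= expf_eq0 => /andP[_ /eqP//].
exists (e * c)%N => [|k]; first by rewrite muln_gt0 e_gt0.
elim: k => [|k IHk].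
  by rewrite muln0 binn; apply: independent_forms1; exists p; apply: ZX.
rewrite addSn binS addnC mulnSr.
apply: independent_forms_add Zfc Xfc _ _ => //; first exact: dhomogMn.
  rewrite -mulnSr [(e * c)%N]mulnC -mulnA addnS -addSn.
  apply: independent_forms_leq (indepZ _).
  by rewrite leq_bin2l // leq_add2r leq_pmull.
Qed.

Lemma independent_forms_chain X n (Z : nat -> set (proj_space K d)) :
  irreducible_chain X n Z ->
  exists2 c, (0 < c)%N & forall k, independent_forms X (c * k) 'C(k + n, n).
Proof.
move=> [ZX Zlt]; suff [c c_gt0 indepZ] : exists2 c, (0 < c)%N &
    forall k, independent_forms (Z n) (c * k) 'C(k + n, n).
  exists c => // k; apply: independent_forms_subset (indepZ k).
  by have [] := ZX n (leqnn n).
elim: n ZX Zlt => [|n IHn] ZX Zlt.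
  exists 1%N => // k; rewrite bin0; apply: independent_forms1.
  by have [[_ []]] := ZX 0%N (leqnn 0).
have [i|i|c c_gt0 indepZ] := IHn; first by move/leqW; apply: ZX.
  by move/leqW; apply: Zlt.
have [[Zn_closed [Zn_neq0 _]] _] := ZX n (leqnSn n).
have [[_ irr] _] := ZX n.+1 (leqnn _).
exact: independent_forms_step (Zlt n (ltnSn n)) c_gt0 indepZ.
Qed.

End HilbertFunction.

(** * The monomial map *)

Section Weights.
Variables (d r : nat) (A : 'M[int]_(r, d.+1)).

(** This is the vector [A al], the exponent of the torus character to which the monomial [x^al]
    restricts. *)
Definition weight (al : 'X_{1..d.+1}) (i : 'I_r) : int :=
  \sum_j A i j * (al j)%:Z.

Lemma monomial_vector_weight (K : fieldType) (s : 'I_r -> K)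
    (al : 'X_{1..d.+1}) :
    (forall i, s i != 0) ->
  \prod_j monomial_vector A s 0 j ^+ al j = \prod_i s i ^ weight al i.
Proof.
move=> s_neq0; under eq_bigr do rewrite mxE -prodrXl.
rewrite exchange_big /=; apply: eq_bigr => i _.
rewrite /weight; elim/big_ind2: _ => [|x1 x2 y1 y2 -> ->|j _];
  first by rewrite expr0z.
  by rewrite expfzDr.
by rewrite exprnP exprz_exp.
Qed.

Lemma entry_bound : exists c : nat, forall i j, `|A i j| <= c%:Z.
Proof.
exists (\sum_i \sum_j `|A i j|)%N => i j.
by rewrite (bigD1 i) //= (bigD1 j) //=; lia.
Qed.

Lemma weight_bound c al i : (forall i j, `|A i j| <= c%:Z) ->
  `|weight al i| <= (c * mdeg al)%:Z.
Proof.
move=> A_le; apply: le_trans (ler_norm_sum _ _ _) _.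
rewrite mdegE big_distrr /= (big_morph Posz PoszD erefl).
apply: ler_sum => j _; rewrite normrM PoszM.
by apply: ler_pM.
Qed.

End Weights.

Section ToricVarieties.
Variables (K : fieldType) (d : nat).

Lemma monomial_vector_neq0 r (A : 'M[int]_(r, d.+1)) (s : 'I_r -> K) j :
  (forall i, s i != 0) -> monomial_vector A s 0 j != 0.
Proof.
by move=> s_neq0; rewrite mxE; apply/prodf_neq0 => i _; rewrite expfz_neq0.
Qed.

(** Zero loci of forms are closed, so vanishing on the closure amounts to vanishing on the image of
    the torus. The ideal of X_A is accessed through this criterion. *)
Lemma toric_sub_zero_locusP r (A : 'M[int]_(r, d.+1)) (f : {mpoly K[d.+1]}) :
  homogeneous f ->
  toric_variety K A `<=` zero_locus [set f] <->
  (forall s, (forall i, s i != 0) -> f.@[monomial_vector A s 0] = 0).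
Proof.
move=> f_homog; rewrite /toric_variety zariski_closure_subP; last first.
  exact: zariski_closed_zero1.
case: f_homog => k f_homog;
  split=> [/sub_zero_locus1 Af s s_neq0|Af p [s s_neq0 ps]].
  have [|p ps] := @homog_coords_point K d (monomial_vector A s).
    by apply/rV0Pn; exists 0; apply: monomial_vector_neq0.
  by apply: (Af p) => //; exists s.
by apply/(zero_locus1P f_homog ps)/Af.
Qed.

Lemma toric_one r (A : 'M[int]_(r, d.+1)) : toric_variety K A (proj_one K d).
Proof.
apply: sub_gen_smallest; exists (fun=> 1) => [i|]; first exact: oner_neq0.
rewrite /homog_coords /=; congr <[_]>%VS; apply/rowP => j; rewrite !mxE.
by rewrite big1 // => i _; rewrite exp1rz.
Qed.

End ToricVarieties.

(** * Irreducibility and inclusions *)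

Lemma exists_nonroot (F : numFieldType) (p : {poly F}) :
  p != 0 -> exists t, p.[t] != 0.
Proof.
move=> p_neq0; apply: contrapT => p_roots.
have := @max_poly_roots _ p [seq i%:R | i <- iota 0 (size p)] p_neq0.
rewrite size_map size_iota ltnn => max_roots; suff: false by [];
  apply: max_roots.
- apply/allP => t _; apply: contrapT => /negP t_nroot.
  by apply: p_roots; exists t.
- by rewrite map_inj_uniq ?iota_uniq // => i j /eqP; rewrite eqr_nat => /eqP.
Qed.

Lemma horner_mmap (F : fieldType) n (f : {mpoly F[n]})
    (h : 'I_n -> {poly F}) t :
  (mmap polyC h f).[t] = f.@[fun j => (h j).[t]].
Proof.
rewrite mevalE /mmap horner_sum; apply: eq_bigr => al _.
rewrite hornerM hornerC horner_prod; congr (_ * _).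
by apply: eq_bigr => j _; rewrite horner_exp.
Qed.

Section Irreducibility.
Variables (K : numFieldType) (d : nat).

(** Adding a constant [c] to all entries of [A] only rescales the monomial vector by the product of
    the [s i ^+ c]. For large [c] the coordinates become polynomial in [s]. *)
Lemma monomial_vector_shift r (A : 'M[int]_(r, d.+1)) :
  exists B : 'I_r -> 'I_d.+1 -> nat,
    forall s : 'I_r -> K, (forall i, s i != 0) ->
    exists2 e, e != 0 & \row_j \prod_i s i ^+ B i j = e *: monomial_vector A s.
Proof.
have [c A_le] := entry_bound A;
  exists (fun i j => absz (A i j + c%:Z)) => s s_neq0.
exists (\prod_i s i ^+ c); first by apply/prodf_neq0 => i _; rewrite expf_neq0.
apply/rowP => j; rewrite !mxE -big_split; apply: eq_bigr => i _ /=.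
rewrite !exprnP -expfzDr //; congr (_ ^ _).
by have := A_le i j; lia.
Qed.

(* Forms that vanish neither at s^A nor at s'^A pull back to nonzero polynomials
   in the parameter of the line through s and s', after A is made nonnegative
   by adding a constant to its entries. *)
Lemma toric_irreducible r (A : 'M[int]_(r, d.+1)) :
  zariski_irreducible (toric_variety K A).
Proof.
split; first by exists (proj_one K d); apply: toric_one.
move=> Z1 Z2 Z1_closed Z2_closed XZ; apply: contrapT => /not_orP[XZ1 XZ2].
have [f f_homog [Z1f Xf]] := separating_form Z1_closed XZ1.
have [g g_homog [Z2g Xg]] := separating_form Z2_closed XZ2.
have Xfg s : (forall i, s i != 0) ->
    f.@[monomial_vector A s 0] * g.@[monomial_vector A s 0] = 0.
  rewrite -mevalM;
    apply: (toric_sub_zero_locusP A (homogeneousM f_homog g_homog)).1.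
  apply/sub_zero_locus1 => p v Xp pv; rewrite mevalM.
  have [Z1p|Z2p] := XZ p Xp.
    by rewrite ((sub_zero_locus1 _ f).2 Z1f p v Z1p pv) mul0r.
  by rewrite ((sub_zero_locus1 _ g).2 Z2g p v Z2p pv) mulr0.
have nonzero h : homogeneous h -> ~ toric_variety K A `<=` zero_locus [set h] ->
    exists2 s, (forall i, s i != 0) & h.@[monomial_vector A s 0] != 0.
  move=> h_homog Xh; apply: contrapT => nos; apply: Xh.
  apply/(toric_sub_zero_locusP A h_homog) => s s_neq0.
  by apply/eqP; apply: contrapT => /negP hs; apply: nos; exists s.
have [B BE] := monomial_vector_shift A.
have [s s_neq0 fs] := nonzero f f_homog Xf.
have [s' s'_neq0 gs'] := nonzero g g_homog Xg.
pose q i : {poly K} := (s i)%:P + (s' i - s i) *: 'X.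
have q0 i : (q i).[0] = s i by
  rewrite hornerD hornerC hornerZ hornerX mulr0 addr0.
have q1 i : (q i).[1] = s' i by
  rewrite hornerD hornerC hornerZ hornerX mulr1 addrC subrK.
pose P h : {poly K} := mmap polyC (fun j => \prod_i q i ^+ B i j) h.
have PE h t : (P h).[t] = h.@[(\row_j \prod_i (q i).[t] ^+ B i j) 0].
  rewrite horner_mmap; apply: meval_eq => j; rewrite mxE horner_prod.
  by apply: eq_bigr => i _; rewrite horner_exp.
have Pneq0 h t k : h \is k.-homog -> (forall i, (q i).[t] != 0) ->
    h.@[monomial_vector A (fun i => (q i).[t]) 0] != 0 -> (P h).[t] != 0.
  move=> h_homog qt_neq0; have [e e_neq0 eE] := BE _ qt_neq0.
  by rewrite PE eE (meval_homogZ _ _ h_homog) mulf_eq0 expf_eq0 (negPf e_neq0)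
    andbF.
have [[k fk] [l gl]] := (f_homog, g_homog).
have Pf : P f != 0.
  suff: (P f).[0] != 0 by apply: contraNneq => ->; rewrite horner0.
  by apply: (Pneq0 _ _ _ fk) => [i|]; rewrite ?(funext q0) ?q0.
have Pg : P g != 0.
  suff: (P g).[1] != 0 by apply: contraNneq => ->; rewrite horner0.
  by apply: (Pneq0 _ _ _ gl) => [i|]; rewrite ?(funext q1) ?q1.
(* This third factor keeps the chosen point of the line inside the torus. *)
have Pq : \prod_i q i != 0.
  apply/prodf_neq0 => i _; apply: contraNneq (s_neq0 i) => qi0.
  by rewrite -q0 qi0 horner0.
have [t] := exists_nonroot (mulf_neq0 (mulf_neq0 Pf Pg) Pq).
rewrite !hornerM horner_prod !mulf_eq0 !negb_or -andbA =>
  /and3P[Pft Pgt /prodf_neq0 qt].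
have qt_neq0 i : (q i).[t] != 0 by apply: qt.
have [e e_neq0 eE] := BE _ qt_neq0.
have /eqP := Xfg _ qt_neq0; rewrite mulf_eq0 => /orP[/eqP ft|/eqP gt].
  by move: Pft; rewrite PE eE (meval_homogZ _ _ fk) ft mulr0 eqxx.
by move: Pgt; rewrite PE eE (meval_homogZ _ _ gl) gt mulr0 eqxx.
Qed.

Lemma toric_projective_variety r (A : 'M[int]_(r, d.+1)) :
  projective_variety (toric_variety K A).
Proof.
split; [exact: zariski_closed_closure | exact: toric_irreducible].
Qed.

End Irreducibility.

Lemma toric_subset (K : numClosedFieldType) d r r'
    (A : 'M[int]_(r, d.+1)) (A' : 'M[int]_(r', d.+1)) :
    (ratmx A <= ratmx A')%MS ->
  toric_variety K A `<=` toric_variety K A'.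
Proof.
move=> /submxP[D AE]; have [k k_gt0 [B BE]] := clear_denominators D.
have kA i j : A i j * k%:Z = \sum_l B i l * A' l j.
  have /matrixP/(_ i j) : k%:R *: map_mx intr A =
      map_mx intr (B *m A') :> 'M[rat]_(r, d.+1).
    by rewrite AE scalemxAl -BE map_mxM.
  by rewrite !mxE mulrC => /eqP;
    rewrite -[_%:R]/(_%:Z%:~R) -rmorphM eqr_int => /eqP.
apply/zariski_closure_subP; first exact: zariski_closed_closure.
apply: subset_trans (@sub_gen_smallest _ _ _) => p [s s_neq0 ps].
(* Since [k A = B A'], the point [t^B] of the second torus is sent by [A'] to [t^(k A) = s^A]. *)
pose t i := k.-root (s i).
have t_neq0 i : t i != 0 by rewrite rootC_eq0.
exists (fun l => \prod_i t i ^ B i l) => [l|].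
  by apply/prodf_neq0 => i _; rewrite expfz_neq0.
suff -> : monomial_vector A' (fun l => \prod_i t i ^ B i l) =
    monomial_vector A s by [].
apply/rowP => j; rewrite !mxE.
transitivity (\prod_i \prod_l t i ^ (B i l * A' l j)).
  rewrite exchange_big; apply: eq_bigr => l _ /=.
  rewrite (big_morph (fun x : K => x ^ A' l j)
    (fun x y => expfzMl x y _) (exp1rz _ _)).
  by apply: eq_bigr => i _; rewrite exprz_exp.
apply: eq_bigr => i _.
rewrite -(big_morph _ (fun m n => expfzDr m n (t_neq0 i)) (expr0z _)) -kA mulrC.
by rewrite -exprz_exp -exprnP rootCK.
Qed.

(** * The tangent space at (1:...:1) *)

(** The Euler operator [x_i d/dx_i] is diagonal on monomials: the factor [u i] restores the exponent
    lowered by the derivative. *)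
Lemma meval_mderiv (F : fieldType) n (f : {mpoly F[n]}) (u : 'I_n -> F) i :
  f^`M(i).@[u] * u i =
  \sum_(al <- msupp f) f@_al * (al i)%:R * \prod_j u j ^+ al j.
Proof.
rewrite /mderiv raddf_sum mulr_suml; apply: eq_bigr => al _ /=.
rewrite mevalZ mevalX [f@__ * _]mulrC -mulrA.
have [->|ali_neq0] := eqVneq (al i) 0%N; first by rewrite !mul0r.
congr (_ * _).
rewrite (bigD1 i) //= [RHS](bigD1 i) //= mnmBE mnmE eqxx subn1.
rewrite mulrAC -exprSr prednK ?lt0n //; congr (_ * _).
by apply: eq_bigr => j ji; rewrite mnmBE mnmE eq_sym (negPf ji) subn0.
Qed.

(* Differentiate [t |-> f (u_0 t^(a_0), ..., u_n t^(a_n))] at [t = 1]. *)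
Lemma mderiv_along_monomial_curve (F : numFieldType) n (f : {mpoly F[n]})
    (u : 'I_n -> F) (a : 'I_n -> nat) :
    (forall t, t != 0 -> f.@[fun i => u i * t ^+ a i] = 0) ->
  \sum_i f^`M(i).@[u] * u i * (a i)%:R = 0.
Proof.
move=> fa; pose P : {poly F} := mmap polyC (fun i => u i *: 'X^(a i)) f.
have PE : P = \sum_(al <- msupp f)
    (f@_al * \prod_j u j ^+ al j) *: 'X^(\sum_i a i * al i).
  rewrite /P /mmap; apply: eq_bigr => al _; rewrite -scalerA -mul_polyC.
  congr (_ * _); rewrite /mmap1 -mul_polyC rmorph_prod -prodrXr -big_split.
  by apply: eq_bigr => i _ /=; rewrite exprZn mul_polyC exprM.
(* The hypothesis covers nonzero [t] only; a nonroot of [P * 'X] is automatically nonzero. *)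
have P0 : P = 0.
  apply/eqP; apply: contraT => P_neq0.
  have [] := @exists_nonroot _ (P * 'X); first by rewrite mulf_neq0 ?polyX_eq0.
  move=> t; rewrite hornerM hornerX mulf_eq0 negb_or => /andP[+ t_neq0].
  rewrite horner_mmap => /eqP[]; rewrite -(fa t t_neq0).
  by apply: meval_eq => i; rewrite hornerZ hornerXn.
transitivity (P^`().[1]); last by rewrite P0 deriv0 horner0.
rewrite PE raddf_sum horner_sum /=.
under eq_bigr do rewrite meval_mderiv mulr_suml.
rewrite exchange_big /=; apply: eq_bigr => al _.
rewrite derivZ derivXn hornerZ hornerMn hornerXn expr1n natr_sum mulr_sumr.
by apply: eq_bigr => i _;
  rewrite natrM [(a i)%:R * _]mulrC mulrA [f@_al * _ * _]mulrAC.
Qed.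

Section TangentSpace.
Variables (K : numFieldType) (d r : nat) (A : 'M[int]_(r, d.+1)).
Implicit Types (v : 'rV[K]_d.+1) (f : {mpoly K[d.+1]}).

(** Every vector of the row span is tangent to X_A at (1:...:1). The scalar [e] accounts for the
    choice of homogeneous coordinates [(e, ..., e)] of that point. *)
Lemma toric_mderiv f e v : homogeneous f ->
    toric_variety K A `<=` zero_locus [set f] -> e != 0 ->
    (v <= map_mx intr A)%MS ->
  \sum_j f^`M(j).@[fun=> e] * v 0 j = 0.
Proof.
move=> f_homog /(toric_sub_zero_locusP A f_homog) fA e_neq0 /submxP[w ->].
have [k fk] := f_homog.
suff rowA i : \sum_j f^`M(j).@[fun=> e] * (A i j)%:~R = 0.
  under eq_bigr do rewrite mxE mulr_sumr.
  rewrite exchange_big big1 // => i _.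
  transitivity (w 0 i * \sum_j f^`M(j).@[fun=> e] * (A i j)%:~R).
    by rewrite mulr_sumr; apply: eq_bigr => j _; rewrite mxE mulrCA.
  by rewrite rowA mulr0.
have [c A_le] := entry_bound A.
(* Exponents must be natural numbers, hence the shift by [c]. The case [m = 1] gives the row shifted
   by [c], the case [m = 0] the shift alone, and their difference the row itself. *)
have curve m (a : 'I_d.+1 -> nat) :
    (forall j, (a j)%:Z = m%:Z * A i j + c%:Z) ->
    \sum_j f^`M(j).@[fun=> e] * (a j)%:R = 0.
  move=> aE; apply: (mulfI e_neq0); rewrite mulr0 mulr_sumr.
  rewrite -[RHS](@mderiv_along_monomial_curve _ _ f (fun=> e) a).
    by apply: eq_bigr => j _; rewrite mulrA [e * _]mulrC.
  move=> t t_neq0.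
  pose s l := if l == i then t ^+ m else 1 : K.
  have s_neq0 l : s l != 0.
    by rewrite /s; case: ifP => _; rewrite ?oner_neq0 ?expf_neq0.
  have -> : f.@[fun j => e * t ^+ a j] =
      f.@[((e * t ^+ c) *: monomial_vector A s) 0].
    apply: meval_eq => j; rewrite !mxE -mulrA; congr (_ * _).
    rewrite (bigD1 i) //= big1 => [|l li]; last by rewrite /s (negPf li) exp1rz.
    by rewrite /s eqxx mulr1 exprnP aE addrC expfzDr // exprnP -exprz_exp.
  by rewrite (meval_homogZ _ _ fk) fA // mulr0.
have A_ge j : (absz (A i j + c%:Z))%:Z = A i j + c%:Z by have := A_le i j; lia.
have c1 : \sum_j f^`M(j).@[fun=> e] * (absz (A i j + c%:Z))%:R = 0.
  by apply: (curve 1%N (fun j => absz (A i j + c%:Z))) => j; rewrite mul1r A_ge.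
have c0 : \sum_j f^`M(j).@[fun=> e] * c%:R = 0.
  by apply: (curve 0%N (fun=> c)) => j; rewrite mul0r add0r.
rewrite -[RHS](subrr 0) -[X in X - _]c1 -[X in _ - X]c0 -sumrB.
apply: eq_bigr => j _; rewrite -mulrBr; congr (_ * _).
by rewrite !pmulrn A_ge rmorphD addrK.
Qed.

(** If [A z = 0] and [z = al - be], the binomial [x^al - x^be] vanishes on X_A and its differential
    at [(1, ..., 1)] is [z]. The vectors orthogonal to all such [z] form the row space. *)
Lemma mderiv_toric v : ((const_mx 1 : 'rV_d.+1) <= ratmx A)%MS ->
    (forall f, homogeneous f -> toric_variety K A `<=` zero_locus [set f] ->
       \sum_j f^`M(j).@[fun=> 1] * v 0 j = 0) ->
  (v <= map_mx intr A)%MS.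
Proof.
move=> /submxP[w wA] fv.
suff kerA (z : 'I_d.+1 -> int) : (forall i, \sum_j A i j * z j = 0) ->
    \sum_j (z j)%:~R * v 0 j = 0.
  (* After clearing denominators, the columns of the cokernel matrix are integral vectors [z] that
     cut out the row space. *)
  have [k k_gt0 [Z ZE]] := clear_denominators (cokermx (map_mx intr A)).
  rewrite submxE map_mx_intr_ratr -map_cokermx.
  suff /eqP : v *m map_mx intr Z = 0.
    rewrite map_mx_intr_ratr ZE map_mxZ -scalemxAr scaler_eq0 rmorph_nat.
    by rewrite pnatr_eq0 gtn_eqF.
  apply/rowP => l; rewrite !mxE -[RHS](kerA (fun j => Z j l)) => [|i].
    by apply: eq_bigr => j _; rewrite !mxE mulrC.
  have : map_mx intr A *m map_mx intr Z = 0 :> 'M[rat]_(r, _).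
    by rewrite ZE -scalemxAr mulmx_coker scaler0.
  rewrite -map_mxM => /matrixP/(_ i l); rewrite !mxE => /eqP.
  by rewrite intr_eq0 => /eqP.
move=> Az;
  pose al := [multinom (if (0 <= z j)%R then absz (z j) else 0%N) | j < d.+1].
pose be := [multinom (if (0 <= z j)%R then 0%N else absz (z j)) | j < d.+1].
have zE j : z j = (al j)%:Z - (be j)%:Z by rewrite !mnmE; case: ifP; lia.
have weight_eq i : weight A al i = weight A be i.
  apply/eqP; rewrite -subr_eq0 -sumrB; apply/eqP.
  rewrite -[RHS](Az i); apply: eq_bigr => j _.
  by rewrite -mulrBr -zE.
(* From [w A = (1, ..., 1)], the sum of the [z j] is [w A z = 0]. This makes the binomial
   homogeneous. *)
have sumz : \sum_j z j = 0.
  suff /eqP : (\sum_j z j)%:~R = 0 :> rat by rewrite intr_eq0 => /eqP.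
  transitivity (\sum_j \sum_i w 0 i * (A i j * z j)%:~R).
    rewrite rmorph_sum; apply: eq_bigr => j _ /=.
    move/rowP/(_ j): wA; rewrite !mxE => wA;
      rewrite -[LHS]mul1r [X in X * _]wA mulr_suml.
    by apply: eq_bigr => i _; rewrite mxE intrM mulrA.
  rewrite exchange_big big1 // => i _ /=.
  by rewrite -mulr_sumr -rmorph_sum Az mulr0.
have mdeg_eq : mdeg al = mdeg be.
  apply/eqP; rewrite -eqz_nat -subr_eq0 !mdegE !(big_morph Posz PoszD erefl).
  by rewrite -sumrB; apply/eqP; rewrite -[RHS]sumz; apply: eq_bigr => j _;
    rewrite -zE.
pose f : {mpoly K[d.+1]} := 'X_[al] - 'X_[be].
have f_homog : homogeneous f.
  by exists (mdeg al); rewrite rpredB ?dhomogX //= mdeg_eq.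
rewrite -[RHS](fv f f_homog); last first.
  apply/(toric_sub_zero_locusP A f_homog) => s s_neq0.
  rewrite mevalB !mevalX !monomial_vector_weight //.
  rewrite -[RHS](subrr (\prod_i s i ^ weight A be i)).
  by congr (_ - _); apply: eq_bigr => i _; rewrite weight_eq.
apply: eq_bigr => j _; congr (_ * _).
have derivX m : ('X_[m] : {mpoly K[d.+1]})^`M(j).@[fun=> 1] = (m j)%:R.
  by rewrite mderivX mevalZ mevalX big1 ?mulr1 // => i _; rewrite expr1n.
by rewrite mderivB mevalB !derivX zE rmorphB.
Qed.

End TangentSpace.

(** * The dimension of toric varieties *)

Section DimensionBound.
Variables (K : fieldType) (d m : nat) (A : 'M[int]_(m.+1, d.+1)).

(** If [w A = (1, ..., 1)], pairing [w] with the weight of [al] gives [mdeg al]. This equation can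
    be solved for any coordinate [i0] with [w 0 i0] nonzero. *)
Lemma weight_determined :
    ((const_mx 1 : 'rV_d.+1) <= ratmx A)%MS ->
  exists i0, forall al be : 'X_{1..d.+1},
  mdeg al = mdeg be ->
    (forall i, weight A al (lift i0 i) = weight A be (lift i0 i)) ->
  weight A al =1 weight A be.
Proof.
move=> /submxP[w wA].
have /rV0Pn[i0 wi0_neq0] : w != 0.
  apply/eqP => w0; move: wA; rewrite w0 mul0mx => /rowP/(_ 0)/eqP.
  by rewrite !mxE oner_eq0.
have weight_mdeg (al : 'X_{1..d.+1}) :
    \sum_i w 0 i * (weight A al i)%:~R = (mdeg al)%:R.
  rewrite mdegE natr_sum;
    under [LHS]eq_bigr do rewrite /weight rmorph_sum mulr_sumr.
  rewrite exchange_big; apply: eq_bigr => j _ /=.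
  move/rowP/(_ j): wA; rewrite !mxE => wA.
  rewrite -[RHS]mul1r [X in X * _]wA mulr_suml; apply: eq_bigr => i _.
  by rewrite mxE intrM mulrA.
exists i0 => al be mdeg_eq weight_eq i.
have [i' ->|->] := unliftP i0 i; first exact: weight_eq.
have : \sum_i w 0 i * (weight A al i)%:~R = \sum_i w 0 i * (weight A be i)%:~R.
  by rewrite !weight_mdeg mdeg_eq.
rewrite (bigD1_ord i0) // [RHS](bigD1_ord i0) //=.
under eq_bigr do rewrite weight_eq.
by move=> /addIr/(mulfI wi0_neq0)/eqP; rewrite eqr_int => /eqP.
Qed.

(* The restrictions of the forms of degree [D] to the torus are spanned by the
   characters of weight [weight A al] with [mdeg al = D]; since (1, ..., 1) is
   in the row span, one of the [m + 1] coordinates of such a weight is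
   determined by the others, which are O(D). *)
Lemma toric_independent_forms :
    ((const_mx 1 : 'rV_d.+1) <= ratmx A)%MS ->
  exists c, forall D N,
  independent_forms (toric_variety K A) D N -> (N <= (c * D).+1 ^ m)%N.
Proof.
move=> /weight_determined[i0 weight_i0].
have [c A_le] := entry_bound A; exists (2 * c)%N => D N [g g_homog g_indep].
pose T := {ffun 'I_m -> 'I_(2 * c * D).+1}.
(* In degree [D] the weights lie between [- c * D] and [c * D]; the shift by [c * D] makes them
   natural numbers at most [2 * c * D], so [inord] truncates nothing. *)
pose code (al : 'X_{1..d.+1}) : T :=
  [ffun i => inord (absz (weight A al (lift i0 i) + (c * D)%:Z))].
have code_weight al be : mdeg al = D -> mdeg be = D -> code al = code be ->
    weight A al =1 weight A be.
  move=> al_D be_D code_eq; apply: weight_i0 => [|i]; first by rewrite al_D.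
  have := congr1 val (congr1 (fun h : T => h i) code_eq).
  have := weight_bound al (lift i0 i) A_le;
    have := weight_bound be (lift i0 i) A_le.
  by rewrite al_D be_D !ffunE /= => be_le al_le; rewrite !inordK; lia.
(* Row [i] lists the coefficients of the restriction of [g i] to the torus, grouped by character. A
   combination killed by [M] vanishes on X_A, so independence makes [M] row free and [N] at most the
   number of codes. *)
pose M := \matrix_(i < N, t < #|T|)
  \sum_(al : 'X_{1..d.+1 < D.+1} | code al == enum_val t) (g i)@_al.
have ME i t : M i (enum_rank t) =
    \sum_(al : 'X_{1..d.+1 < D.+1} | code al == t) (g i)@_al.
  by rewrite mxE enum_rankK.
suff M_inj (a : 'rV_N) : a *m M = 0 -> a = 0.
  have : row_free M.
    rewrite -kermx_eq0; apply/eqP/row_matrixP => l; rewrite row0.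
    by apply: M_inj; rewrite -row_mul mulmx_ker row0.
  move=> /eqP <-; apply: leq_trans (rank_leq_col _) _.
  by rewrite card_ffun !card_ord.
move: M ME => M ME aM.
pose f := \sum_i a 0 i *: g i.
have f_homog : f \is D.-homog.
  by apply: rpred_sum => i _; apply/rpredZ/g_homog.
have sum_code t : \sum_(al : 'X_{1..d.+1 < D.+1} | code al == t) f@_al = 0.
  move: aM => /rowP/(_ (enum_rank t)); rewrite mxE [RHS]mxE => {2}<-.
  under [RHS]eq_bigr do rewrite ME mulr_sumr.
  rewrite exchange_big; apply: eq_bigr => al _; rewrite raddf_sum.
  by apply: eq_bigr => i _ /=; rewrite mcoeffZ.
have f_size : (msize f <= D.+1)%N.
  rewrite msizeE; apply/bigmax_leqP_seq => al al_f _.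
  by rewrite (dhomog_mf f_homog al_f).
apply/rowP => i; rewrite [RHS]mxE; move: i; apply: g_indep.
apply/toric_sub_zero_locusP => [|s s_neq0]; first by exists D.
rewrite -/f (mpolywE f_size) raddf_sum.
rewrite (partition_big (fun al : 'X_{1..d.+1 < D.+1} => code al) xpredT) //=.
apply: big1 => t _.
(* The sum also runs over exponents of degree below [D], whose coefficients in [f] are 0. A code may
   come from such exponents only. *)
have [[al0 [al0_D al0_t]]|noal] :=
  pselect (exists al, mdeg al = D /\ code al = t).
  transitivity ((\sum_(al : 'X_{1..d.+1 < D.+1} | code al == t) f@_al) *
                \prod_i s i ^ weight A al0 i); last by rewrite sum_code mul0r.
  rewrite mulr_suml; apply: eq_bigr => al /eqP al_t; rewrite mevalZ.
  have [al_D|al_D] := eqVneq (mdeg al) D; last first.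
    by rewrite (dhomog_nemf_coeff f_homog al_D) !mul0r.
  rewrite mevalX monomial_vector_weight //; congr (_ * _).
  by apply: eq_bigr => i _; rewrite (code_weight al al0) // al_t.
apply: big1 => al /eqP al_t; rewrite mevalZ.
have [al_D|al_D] := eqVneq (mdeg al) D; first by case: noal; exists al.
by rewrite (dhomog_nemf_coeff f_homog al_D) mul0r.
Qed.

Lemma toric_chain_leq n Z :
    ((const_mx 1 : 'rV_d.+1) <= ratmx A)%MS ->
  irreducible_chain (toric_variety K A) n Z -> (n <= m)%N.
Proof.
move=> /toric_independent_forms[c' le_c'] /independent_forms_chain[c _ indep].
apply: (@leq_of_bin_leq_exp _ _ (c' * c)) => k; rewrite -mulnA.
exact/le_c'/indep.
Qed.

End DimensionBound.

Section ToricDimension.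
Variables (K : numClosedFieldType) (d : nat).

(** If X_A lies in X_A', forms vanishing on X_A' vanish on X_A, so the rows of [A] satisfy all
    tangent equations of X_A' at (1:...:1). *)
Lemma toric_subsetP r r' (A : 'M[int]_(r, d.+1)) (A' : 'M[int]_(r', d.+1)) :
    ((const_mx 1 : 'rV_d.+1) <= ratmx A')%MS ->
  toric_variety K A `<=` toric_variety K A' <->
  (ratmx A <= ratmx A')%MS.
Proof.
move=> one_A'; split; last exact: toric_subset.
move=> AA'; rewrite -(submx_intr K); apply/row_subP => i.
apply: mderiv_toric => // f f_homog A'f.
apply: (@toric_mderiv _ _ _ A) => //; last exact: row_sub.
  exact: subset_trans A'f.
exact: oner_neq0.
Qed.

(** The row space is cut by a linear form [h] that vanishes on [(1, ..., 1)] but not on the whole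
    space. *)
Lemma rational_hyperplane n r (A : 'M[int]_(r, d.+1)) :
    ((const_mx 1 : 'rV_d.+1) <= ratmx A)%MS ->
    \rank (ratmx A) = n.+2 ->
  exists A' : 'M[int]_(d.+1, d.+1),
    [/\ ((const_mx 1 : 'rV_d.+1) <= ratmx A')%MS,
        \rank (ratmx A') = n.+1 &
        (ratmx A' <= ratmx A)%MS].
Proof.
set W := map_mx intr A => one_W rankW.
(* The columns of this cokernel cut out the line of [(1, ..., 1)]; if all of them killed [W], its
   rank would be at most 1. *)
have [j Wj_neq0] : exists j, W *m col j (cokermx (const_mx 1 : 'rV_d.+1)) != 0.
  apply: contrapT => noj.
  suff : (W <= (const_mx 1 : 'rV_d.+1))%MS.
    by move=> /mxrankS; rewrite rankW => /leq_trans/(_ (rank_leq_row _)).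
  rewrite submxE; apply/eqP/matrixP => i j; rewrite [RHS]mxE.
  apply: contrapT => Wij; apply: noj; exists j; apply: contra_not_neq Wij.
  by rewrite colE mulmxA -colE => /colP/(_ i); rewrite !mxE.
set h := col j _ in Wj_neq0.
have [A' A'E] := eqmx_clear_denominators (W :&: kermx h)%MS.
exists A'; split; rewrite ?A'E ?capmxSl //.
- rewrite sub_capmx one_W; apply/sub_kermxP.
  by rewrite /h colE mulmxA mulmx_coker mul0mx.
- have := mxrank_mul_ker W h; rewrite rankW.
  suff -> : \rank (W *m h) = 1%N by rewrite add1n => -[].
  by apply/eqP; rewrite eqn_leq rank_leq_col lt0n mxrank_eq0.
Qed.

Lemma toric_chain n r (A : 'M[int]_(r, d.+1)) :
    ((const_mx 1 : 'rV_d.+1) <= ratmx A)%MS ->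
    \rank (ratmx A) = n.+1 ->
  exists Z, irreducible_chain (toric_variety K A) n Z.
Proof.
elim: n r A => [|n IHn] r A one_A rankA.
  exists (fun=> toric_variety K A).
  by split=> // i _; split=> //; apply: toric_projective_variety.
have [A' [one_A' rankA' A'A]] := rational_hyperplane one_A rankA.
have [Z [ZA' Zlt]] := IHn _ A' one_A' rankA'.
have A'A_sub := @toric_subset K _ _ _ _ _ A'A.
exists (fun i => if (i <= n)%N then Z i else toric_variety K A); split=> i.
  case: (leqP i n) => [i_le _|_ _]; last first.
    by split=> //; apply: toric_projective_variety.
  by have [? ZiA'] := ZA' i i_le; split=> //; apply: subset_trans A'A_sub.
rewrite ltnS => i_le; rewrite i_le; case: ltnP => [/Zlt//|n_le].
have [_ ZiA'] := ZA' i i_le; split; first exact: subset_trans A'A_sub.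
(* Only the last inclusion needs an argument: if X_A lay in the top member of the chain of X_A', the
   rank of [A] would not exceed that of [A']. *)
move=> AZi;
  have /(toric_subsetP _ one_A') : toric_variety K A `<=` toric_variety K A'.
  exact: subset_trans ZiA'.
by move=> /mxrankS; rewrite rankA rankA' ltnn.
Qed.

Lemma toric_dimension m (A : 'M[int]_(m.+1, d.+1)) :
    ((const_mx 1 : 'rV_d.+1) <= ratmx A)%MS ->
    \rank (ratmx A) = m.+1 ->
  has_dimension (toric_variety K A) m.
Proof.
move=> one_A rankA; split; first exact: toric_chain.
by move=> k Z; apply: toric_chain_leq.
Qed.

Lemma toric_tangent_locus r (A : 'M[int]_(r, d.+1)) :
    ((const_mx 1 : 'rV_d.+1) <= ratmx A)%MS ->
  tangent_locus (toric_variety K A) (proj_one K d) =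
  projectivization <<[seq row i (map_mx intr A) | i <- enum 'I_r]>>%VS.
Proof.
move=> one_A; apply/seteqP; split=> q.
  have [v qv] := homog_coords_exists q => Tq.
  rewrite /projectivization /= qv -memvE mem_span_rows.
  apply: mderiv_toric => // f f_homog fA.
  have := Tq f f_homog fA (const_mx 1) v erefl qv.
  suff -> : (const_mx 1 : 'rV[K]_d.+1) 0 = fun=> 1 by [].
  by apply/funext => j; rewrite mxE.
move=> qA f f_homog fA u v onep qv.
have vA : (v <= map_mx intr A)%MS.
  by rewrite -mem_span_rows memvE -qv.
have [e e_neq0 ->] := @homog_coordsZ K d (proj_one K d) (const_mx 1) u erefl
  onep.
have -> : (e *: (const_mx 1 : 'rV[K]_d.+1)) 0 = fun=> e.
  by apply/funext => j; rewrite !mxE mulr1.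
exact: toric_mderiv vA.
Qed.

End ToricDimension.

(** * Real row spans *)

Lemma projectivization_inj (K : fieldType) d (V W : {vspace 'rV[K]_d.+1}) :
  projectivization V = projectivization W -> V = W.
Proof.
have sub (V' W' : {vspace 'rV[K]_d.+1}) :
    projectivization V' = projectivization W' -> (V' <= W')%VS.
  move=> VW; apply/subvP => v vV; have [->|v_neq0] := eqVneq v 0;
    first exact: mem0v.
  have [p pv] := homog_coords_point v_neq0.
  have : projectivization V' p by rewrite /projectivization /= pv -memvE.
  by rewrite VW /projectivization /= pv -memvE.
by move=> VW; apply/eqP; rewrite eqEsubv !sub.
Qed.

Section RealToric.
Variables (R : realType) (d : nat).

Lemma one_rowspan r (A : 'M[int]_(r, d.+1)) :
  (const_mx 1 \in rowspan R A) =
  ((const_mx 1 : 'rV_d.+1) <= ratmx A)%MS.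
Proof. by rewrite mem_rowspan const1_sub_intr. Qed.

Lemma toric_tangent_rowspan r (A : 'M[int]_(r, d.+1)) :
  const_mx 1 \in rowspan R A ->
  tangent_locus (toric_variety R[i] A) (proj_one R[i] d) =
  projectivization (complexification (rowspan R A)).
Proof.
by rewrite one_rowspan => /toric_tangent_locus ->;
  rewrite complexification_rowspanE.
Qed.

Lemma toric_embedded_tangent_space m (A : 'M[int]_(m.+1, d.+1)) :
    \dim (rowspan R A) = m.+1 -> const_mx 1 \in rowspan R A ->
  is_embedded_tangent_space (toric_variety R[i] A) (proj_one R[i] d)
    (projectivization (complexification (rowspan R A))).
Proof.
move=> dimA one_A; split; first exact: toric_projective_variety.
  split; first exact: toric_one.
  exists m, (complexification (rowspan R A)); split.
  - by apply: toric_dimension; rewrite -?one_rowspan -?(dim_rowspan R).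
  - exact: toric_tangent_rowspan.
  - by rewrite complexification_rowspanE dim_span_rows mxrank_intr
    -(dim_rowspan R).
by rewrite toric_tangent_rowspan.
Qed.

(** The numbers of rows may differ, as uniqueness is claimed among toric varieties given by matrices
    of any size. *)
Lemma eq_toric_rowspan r r' (A : 'M[int]_(r, d.+1)) (A' : 'M[int]_(r', d.+1)) :
    const_mx 1 \in rowspan R A -> const_mx 1 \in rowspan R A' ->
  toric_variety R[i] A = toric_variety R[i] A' <-> rowspan R A = rowspan R A'.
Proof.
move=> one_A one_A'; split=> [AA'|/eqP].
  apply/complexification_inj/projectivization_inj.
  by rewrite -!toric_tangent_rowspan // AA'.
rewrite eqEsubv !rowspan_subE => /andP[AA' A'A].
by apply/seteqP; split; apply: toric_subset.
Qed.

Lemma toric_equivariantly_embedded m (A : 'M[int]_(m.+1, d.+1)) :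
    \dim (rowspan R A) = m.+1 -> const_mx 1 \in rowspan R A ->
  is_equivariantly_embedded_toric (toric_variety R[i] A).
Proof.
move=> dimA one_A; exists m.+1, A; split=> //.
(* The rank [m.+1] is at most the number [d.+1] of columns. *)
by rewrite dimA; apply/esym/minn_idPl; rewrite -dimA dim_rowspan rank_leq_col.
Qed.

End RealToric.

Theorem theorem2p5 (R : realType) (m d : nat) :
  (forall A : 'M[int]_(m.+1, d.+1),
     \dim (rowspan R A) = m.+1 -> const_mx 1 \in rowspan R A ->
     (forall A' : 'M[int]_(m.+1, d.+1),
        \dim (rowspan R A') = m.+1 -> const_mx 1 \in rowspan R A' ->
        (toric_variety R[i] A = toric_variety R[i] A' <->
         rowspan R A = rowspan R A'))
     /\
     is_embedded_tangent_space (toric_variety R[i] A) (proj_one R[i] d)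
       (projectivization (complexification (rowspan R A))))
  /\
  (forall L : {vspace 'rV[R]_d.+1},
     \dim L = m.+1 -> defined_over_rat L -> const_mx 1 \in L ->
     (exists! X : set (proj_space R[i] d),
        is_equivariantly_embedded_toric X /\
        is_embedded_tangent_space X (proj_one R[i] d)
          (projectivization (complexification L)))
     /\
     (exists A : 'M[int]_(m.+1, d.+1), L = rowspan R A)
     /\
     (forall A : 'M[int]_(m.+1, d.+1), L = rowspan R A ->
        is_equivariantly_embedded_toric (toric_variety R[i] A) /\
        is_embedded_tangent_space (toric_variety R[i] A) (proj_one R[i] d)
          (projectivization (complexification L)))).
Proof.
split=> [A dimA one_A|L dimL ratL one_L].
  split=> [A' dimA' one_A'|]; last exact: toric_embedded_tangent_space.
  exact: eq_toric_rowspan.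
have [A LA] := rational_rowspan dimL ratL.
have toricL (B : 'M[int]_(m.+1, d.+1)) : L = rowspan R B ->
    is_equivariantly_embedded_toric (toric_variety R[i] B) /\
    is_embedded_tangent_space (toric_variety R[i] B) (proj_one R[i] d)
      (projectivization (complexification L)).
  move=> LB; rewrite LB; rewrite LB in dimL one_L.
  by split; [apply: toric_equivariantly_embedded|apply:
    toric_embedded_tangent_space].
split; last by split; first by exists A.
exists (toric_variety R[i] A); split; first exact: toricL.
(* A competitor X_B has the same tangent space at (1:...:1), so the complexified row span of [B] is
   that of [L], and descending to the reals the row span of [B] is [L]. *)
move=> X [[r [B [_ one_B ->]]] [_ _ tangentB]].
apply/(eq_toric_rowspan (R := R)); rewrite -?LA //.
apply/complexification_inj/projectivization_inj.
by rewrite tangentB toric_tangent_rowspan.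
Qed.
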